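(* Let $G\in C^1(\mathbb R^{n+1}\setminus\{0\},\mathbb R^{(n+1)\times(n+1)})$ be a weight matrix, let $R>0$, and let $\Omega\subset B_R(0)=\{x\in\mathbb R^n:|x|<R\}$ be a bounded domain. Let $u\in C^2(\Omega,\mathbb R)\cap C^0(\overline\Omega,\mathbb R)$ be a graph of prescribed weighted mean curvature $\mathcal H:\overline\Omega\times\mathbb R\to\mathbb R$, and assume $$|\mathcal H(x,z)|\le\frac1R\,\mathrm{tr}\,G(p)\quad\text{for all }x\in\Omega,\ z\in\mathbb R,\ p\in S^n .$$ Then $$\sup_\Omega|u(x)|\le\sup_{\partial\Omega}|u(x)|+R .$$
   Context: A weight matrix is a map $G=G(p)$ from $\mathbb R^{n+1}\setminus\{0\}$ to the symmetric real $(n+1)\times(n+1)$ matrices such that (i) $\langle G(p)y,y\rangle>0$ for all $p\neq 0$ and all $y\in p^\perp\setminus\{0\}$; (ii) $t\,G(tp)=G(p)$ and $G(p)p=0$ for all $p\ne0$, $t>0$. For an immersion $X$ with unit normal $N$ put $g_{ij}=\langle\partial_iX,\partial_jX\rangle$, $b_{ij}=\langle\partial_{ij}X,N\rangle$, $S=g^{-1}b$, $A_G=(a_{ij})$ with $a_{ij}=\langle G(N)\partial_iX,\partial_jX\rangle$. The weighted mean curvature is $H_G=\mathrm{tr}(g^{-1}A_GS)$. The function $u$ is a graph of prescribed weighted mean curvature $\mathcal H$ if the immersion $X(x)=(x,u(x))$ with upper normal $N=(1+|\nabla u|^2)^{-1/2}(-\nabla u,1)$ satisfies $H_G(x)=\mathcal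 H(x,u(x))$ for all $x\in\Omega$. *)

(* Defs.v *)
(* MathComp / MathComp-Analysis; the real numbers are an arbitrary R : realType. *)
From HB Require Import structures.
From mathcomp Require Import all_boot all_order all_algebra.
From mathcomp Require Import all_classical all_reals all_analysis.

Set Implicit Arguments.
Unset Strict Implicit.
Unset Printing Implicit Defensive.

Import Order.TTheory GRing.Theory Num.Theory.
Import numFieldNormedType.Exports.

Local Open Scope classical_set_scope.
Local Open Scope ring_scope.

Section Euclidean.
Context {R : realType}.

(* Points of R^m are row vectors.  The library norm `|x| on 'rV[R]_m is the sup
   norm: it induces the usual topology, but is not the Euclidean length. *)
Definition dotv m (x y : 'rV[R]_m) : R := \sum_i x 0 i * y 0 i.

Definition enorm m (x : 'rV[R]_m) : R := Num.sqrt (dotv x x).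

Definition eball m (r : R) : set 'rV[R]_m := [set x | enorm x < r].

(* The vector A y, written for a row vector y. *)
Definition mxapp m (A : 'M[R]_m) (y : 'rV[R]_m) : 'rV[R]_m := y *m A^T.

End Euclidean.

Section Topology.
Context {T : topologicalType}.

Definition is_domain (A : set T) : Prop := [/\ A !=set0, open A & connected A].

Definition boundary (A : set T) : set T := closure A `\` interior A.

End Topology.

(* C^k on an open set U; U must be open, since derivatives and continuity are
   those of the total function f at the points of U.  On a finite-dimensional
   space V, f is C^(k.+1) on U iff it is differentiable at every point of U and
   all its directional derivatives x |-> ('d f x) v are C^k on U. *)
Fixpoint class_C {R : realType} {V W : normedModType R} (k : nat) (U : set V)
    (f : V -> W) : Prop :=
  match k with
  | 0 => forall x, U x -> {for x, continuous f}
  | k'.+1 => (forall x, U x -> differentiable f x) /\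
             (forall v : V, class_C k' U (fun x => 'D_v f x))
  end.

Definition partial {R : realType} {n : nat} {W : normedModType R} (i : 'I_n)
    (f : 'rV[R]_n -> W) : 'rV[R]_n -> W :=
  fun x => 'D_(delta_mx 0 i) f x.

Section WeightedMeanCurvature.
Context {R : realType}.

(* G is a total function; its value at 0 is never constrained nor used. *)
Record weight_matrix m (G : 'rV[R]_m -> 'M[R]_m) : Prop := WeightMatrix {
  weight_sym : forall p, p != 0 -> (G p)^T = G p;
  weight_pos : forall p y, p != 0 -> dotv y p = 0 -> y != 0 ->
    0 < dotv (mxapp (G p) y) y;
  weight_hom : forall p t, p != 0 -> 0 < t -> t *: G (t *: p) = G p;
  weight_ker : forall p, p != 0 -> mxapp (G p) p = 0
}.

Section Immersion.
Variables (n m : nat) (X N : 'rV[R]_n -> 'rV[R]_m).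

Definition first_form (x : 'rV[R]_n) : 'M[R]_n :=
  \matrix_(i, j) dotv (partial i X x) (partial j X x).

Definition second_form (x : 'rV[R]_n) : 'M[R]_n :=
  \matrix_(i, j) dotv (partial i (partial j X) x) (N x).

Definition shape_operator (x : 'rV[R]_n) : 'M[R]_n :=
  invmx (first_form x) *m second_form x.

Definition weighted_form (G : 'rV[R]_m -> 'M[R]_m) (x : 'rV[R]_n) : 'M[R]_n :=
  \matrix_(i, j) dotv (mxapp (G (N x)) (partial i X x)) (partial j X x).

Definition weighted_mean_curvature (G : 'rV[R]_m -> 'M[R]_m) (x : 'rV[R]_n) : R :=
  \tr (invmx (first_form x) *m weighted_form G x *m shape_operator x).

End Immersion.

Section Graph.
Variables (n : nat) (u : 'rV[R]_n -> R).

Definition graph_imm (x : 'rV[R]_n) : 'rV[R]_(n + 1) := row_mx x (u x)%:M.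

Definition gradient (x : 'rV[R]_n) : 'rV[R]_n := \row_i partial i u x.

Definition upper_normal (x : 'rV[R]_n) : 'rV[R]_(n + 1) :=
  (Num.sqrt (1 + enorm (gradient x) ^+ 2))^-1 *: row_mx (- gradient x) 1%:M.

Definition prescribed_wmc (G : 'rV[R]_(n + 1) -> 'M[R]_(n + 1))
    (Omega : set 'rV[R]_n) (H : 'rV[R]_n -> R -> R) : Prop :=
  forall x, Omega x ->
    weighted_mean_curvature graph_imm upper_normal G x = H x (u x).

End Graph.

End WeightedMeanCurvature.

(* Main.v *)
(** A trace inequality removes the anisotropy: with metric [g], normal [N] and
    [P = g^-1 A_G g^-1], which is positive definite, [H_G = tr (P b)] and
    [tr (P g) = tr (G N)].  So [|H_G| <= tr (G N) / r] forbids [s b + g / r < 0]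
    for both signs [s = 1] and [s = -1].

    If [s u] exceeded its boundary bound by more than [r] somewhere, then, by
    compactness, the points of [closure Omega] where [s u] is above that bound
    would stay in a ball of radius [< r], so a half-sphere of some radius
    [rho < r], centred over the origin, could be slid down until it touches the
    graph of [s u] from above at an interior point.  There
    [s b <= - g / rho < - g / r], a contradiction.  Shrinking the sphere replaces
    the strong maximum principle. *)
Require Import Defs.
From HB Require Import structures.
From mathcomp Require Import all_boot all_order all_algebra.
From mathcomp Require Import all_classical all_reals all_analysis.
From mathcomp Require Import ring lra.

Set Implicit Arguments.
Unset Strict Implicit.
Unset Printing Implicit Defensive.

Import Order.TTheory GRing.Theory Num.Theory.
Import numFieldNormedType.Exports.

Local Open Scope classical_set_scope.
Local Open Scope ring_scope.

(** * Positive definite matrices *)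

Definition posdef {F : realFieldType} n (A : 'M[F]_n) : Prop :=
  forall v : 'rV[F]_n, v != 0 -> 0 < (v *m A *m v^T) 0 0.

Section PositiveDefinite.
Context {F : realFieldType}.

(** Gaussian elimination of the first variable: [w] is the first row and [D] the Schur complement of
    the entry [a]. Splitting off a rank-one square drives the induction for the trace inequality. *)
Lemma posdef_schur n (P : 'M[F]_(1 + n)) (a := P 0 0) (w := usubmx P)
    (D := drsubmx P - a^-1 *: (dlsubmx P *m ursubmx P)) :
  P^T = P -> posdef P ->
  [/\ 0 < a, P = a^-1 *: (w^T *m w) + block_mx 0 0 0 D, D^T = D & posdef D].
Proof.
move=> Psym Ppos.
have a_gt0 : 0 < a.
  have /Ppos : delta_mx 0 0 != 0 :> 'rV[F]_(1 + n).
    by apply/eqP => /matrixP/(_ 0 0); rewrite !mxE /= => /eqP; rewrite oner_eq0.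
  by rewrite -rowE trmx_delta -colE !mxE.
have aE : ulsubmx P = a%:M.
  by rewrite [LHS]mx11_scalar !mxE !lshift0.
have dlE : dlsubmx P = (ursubmx P)^T by rewrite -{1}Psym trmx_ursub.
have wE : w = row_mx a%:M (ursubmx P) by rewrite -aE hsubmxK.
have PE : P = a^-1 *: (w^T *m w) + block_mx 0 0 0 D.
  rewrite -{1}(submxK P) wE tr_row_mx mul_col_row scale_block_mx add_block_mx.
  rewrite !addr0 tr_scalar_mx /D dlE aE; congr block_mx.
  - by rewrite -scalar_mxM scale_scalar_mx mulKf ?gt_eqF.
  - by rewrite mul_scalar_mx scalerA mulVf ?gt_eqF // scale1r.
  - by rewrite mul_mx_scalar scalerA mulVf ?gt_eqF // scale1r.
  - by rewrite addrC subrK.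
have Dsym : D^T = D.
  rewrite /D linearB /= linearZ /= trmx_mul trmx_drsub trmx_ursub trmx_dlsub.
  by rewrite Psym.
split=> // v v0.
(* Chosen to make [row_mx t%:M v] orthogonal to [w], so that the form of [P] there reduces to the
   form of [D] at [v]. *)
pose t := - (a^-1 * (v *m (ursubmx P)^T) 0 0).
have y0 : row_mx t%:M v != 0 :> 'rV[F]_(1 + n).
  by apply: contra_neq v0; rewrite -row_mx0 => /eq_row_mx[].
have yw : row_mx t%:M v *m w^T = 0.
  rewrite wE tr_row_mx mul_row_col tr_scalar_mx -scalar_mxM.
  rewrite [v *m _]mx11_scalar -raddfD /= /t mulNr mulrAC mulVf ?gt_eqF //.
  by rewrite mul1r addNr raddf0.
have := Ppos _ y0; rewrite PE mulmxDr mulmxDl -scalemxAr mulmxA yw mul0mx.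
rewrite scaler0 mul0mx add0r mul_row_block !mulmx0 !add0r tr_row_mx mul_row_col.
by rewrite mul0mx add0r.
Qed.

(** Induction on the size: the rank-one part of [P] contributes a positive multiple of [w B w^T],
    and the Schur complement pairs with the lower right block of [B]. Only [P] is taken symmetric,
    so a Hessian can enter [B] without Schwarz's theorem. *)
Lemma mxtrace_mul_gt0 n (P B : 'M[F]_n) :
  (0 < n)%N -> P^T = P -> posdef P -> posdef B -> 0 < \tr (P *m B).
Proof.
elim: n => [|n IHn] // in P B * => _.
rewrite -[n.+1]/(1 + n)%N in P B * => Psym Ppos Bpos.
have [a_gt0 PE Dsym Dpos] := posdef_schur Psym Ppos.
set a := P 0 0 in a_gt0 PE; set w := usubmx P in PE.
set D := drsubmx P - _ in PE Dsym Dpos.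
have w0 : w != 0.
  apply/eqP => w0; move: a_gt0.
  have -> : a = w 0 0 by rewrite mxE lshift0.
  by rewrite w0 mxE ltxx.
have wBw : 0 < \tr (a^-1 *: (w^T *m w) *m B).
  rewrite -scalemxAl mxtraceZ mulr_gt0 ?invr_gt0 // -mulmxA mxtrace_mulC.
  by rewrite trace_mx11 Bpos.
rewrite PE mulmxDl mxtraceD ltr_pwDl // -[B]submxK mulmx_block.
rewrite !mul0mx !addr0 !add0r mxtrace_block mxtrace0 add0r.
(* An empty remaining block has trace 0; the induction hypothesis covers positive sizes. *)
have [n0|n_gt0] := posnP n.
  by rewrite /mxtrace big1 // => i; suff: (i < 0)%N by []; rewrite -n0.
apply/ltW/IHn => // v v0.
have y0 : row_mx 0 v != 0 :> 'rV[F]_(1 + n).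
  by apply: contra_neq v0; rewrite -row_mx0 => /eq_row_mx[].
have := Bpos _ y0; rewrite -{1}[B]submxK mul_row_block !mul0mx !add0r.
by rewrite tr_row_mx mul_row_col trmx0 mulmx0 add0r.
Qed.

Lemma posdef_unitmx n (A : 'M[F]_n) : posdef A -> A \in unitmx.
Proof.
move=> Apos; rewrite -row_free_unit -kermx_eq0; apply/eqP/row_matrixP => i.
rewrite row0; apply/eqP/contraT => /Apos.
by rewrite -row_mul mulmx_ker row0 mul0mx mxE ltxx.
Qed.

Lemma mulmx_tr_ge0 n (v : 'rV[F]_n) : 0 <= (v *m v^T) 0 0.
Proof. by rewrite mxE sumr_ge0 // => i _; rewrite mxE -expr2 sqr_ge0. Qed.

Lemma mulmx_tr_gt0 n (v : 'rV[F]_n) : v != 0 -> 0 < (v *m v^T) 0 0.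
Proof.
move=> v0; rewrite lt_neqAle mulmx_tr_ge0 andbT eq_sym; apply: contra v0.
rewrite mxE psumr_eq0; last by move=> i _; rewrite mxE -expr2 sqr_ge0.
move=> /allP h; apply/eqP/rowP => j; rewrite mxE.
by have := h j (mem_index_enum _); rewrite mxE -expr2 sqrf_eq0 => /eqP.
Qed.

End PositiveDefinite.

(** * Weighted traces on a tangent space *)

Section WeightedTrace.
Context {F : realFieldType} {n : nat}.
Variables (J : 'M[F]_(n, n + 1)) (N : 'rV[F]_(n + 1)).
Hypotheses (N_unit : N *m N^T = 1%:M) (J_tangent : J *m N^T = 0).
Hypothesis g_pos : posdef (J *m J^T).
Let g := J *m J^T.

(** The summands are the orthogonal projections onto the row space of [J] and onto the normal line.
    Both sides agree after left multiplication by the stacked matrix [K], invertible because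
    [K *m K^T] is block diagonal with blocks [g] and 1. *)
Lemma tangent_projection : J^T *m invmx g *m J + N^T *m N = 1%:M.
Proof.
have gU : g \in unitmx := posdef_unitmx g_pos.
pose K := col_mx J N.
have KK : K *m K^T = block_mx g 0 0 1%:M.
  rewrite tr_col_mx mul_col_row N_unit J_tangent; congr block_mx.
  by rewrite -[LHS]trmxK trmx_mul trmxK J_tangent trmx0.
have KU : K \in unitmx.
  have : K *m K^T \in unitmx by rewrite KK unitmxE det_ublock det1 mulr1.
  by rewrite unitmx_mul => /andP[].
rewrite -[LHS](mulKmx KU) -[RHS](mulKmx KU); congr (_ *m _).
rewrite mulmx1 mul_col_mx; congr col_mx; rewrite mulmxDr !mulmxA.
  by rewrite J_tangent mul0mx addr0 mulmxV // mul1mx.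
rewrite N_unit mul1mx -[N *m J^T]trmxK trmx_mul trmxK J_tangent trmx0.
by rewrite !mul0mx add0r.
Qed.

Variable A : 'M[F]_(n + 1).
Hypotheses (A_sym : A^T = A) (A_ker : N *m A = 0).
Hypothesis A_pos : forall y : 'rV_(n + 1),
  y *m N^T = 0 -> y != 0 -> 0 < (y *m A *m y^T) 0 0.

(** This is [0 < tr (P (b + k g))] rearranged; it is applied with [k = - r^-1]. *)
Lemma weighted_trace_gt (b : 'M[F]_n) (k : F) : (0 < n)%N ->
  posdef (b + k *: g) ->
  - (k * \tr A) < \tr (invmx g *m (J *m A *m J^T) *m (invmx g *m b)).
Proof.
move=> n_gt0 bpos; have gU : g \in unitmx := posdef_unitmx g_pos.
have gsym : (invmx g)^T = invmx g by rewrite trmx_inv trmx_mul trmxK.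
pose P := invmx g *m (J *m A *m J^T) *m invmx g.
have Psym : P^T = P by rewrite /P !trmx_mul trmxK gsym A_sym !mulmxA.
have Ppos : posdef P.
  move=> v v0.
  have y0 : v *m invmx g *m J != 0.
    (* Multiplication by [J^T] recovers [v], so this tangent vector is nonzero and [A_pos] applies
       to it. *)
    apply: contra_neq v0 => y0.
    have := congr1 (mulmxr J^T) y0; rewrite /= mul0mx -mulmxA.
    by rewrite mulmxKV.
  have yN : v *m invmx g *m J *m N^T = 0 by rewrite -mulmxA J_tangent mulmx0.
  by have := A_pos yN y0; rewrite !trmx_mul gsym /P !mulmxA.
(* By cyclicity the left side is the trace of [A] times the tangential projection; the normal part
   adds nothing because [A] kills [N]. *)
have Pg : \tr (P *m g) = \tr A.
  rewrite /P mulmxKV // -!mulmxA mxtrace_mulC -!mulmxA mxtrace_mulC.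
  have -> : \tr A = \tr (A *m (J^T *m invmx g *m J + N^T *m N)).
    by rewrite tangent_projection mulmx1.
  have A_kerr : A *m N^T = 0 by rewrite -A_sym -trmx_mul A_ker trmx0.
  by rewrite mulmxDr !mulmxA A_kerr mul0mx addr0.
have := mxtrace_mul_gt0 n_gt0 Psym Ppos bpos.
rewrite mulmxDr -scalemxAr mxtraceD mxtraceZ Pg /P !mulmxA.
by rewrite -ltrBlDr sub0r.
Qed.

End WeightedTrace.

(** * Geometry of graphs *)

Lemma dotvE (R : realType) m (x y : 'rV[R]_m) : dotv x y = (x *m y^T) 0 0.
Proof. by rewrite mxE; apply: eq_bigr => i _; rewrite mxE. Qed.

Lemma enorm_sqr (R : realType) m (x : 'rV[R]_m) : enorm x ^+ 2 = dotv x x.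
Proof. by rewrite sqr_sqrtr // dotvE mulmx_tr_ge0. Qed.

Lemma is_derive_row_mx (R : realType) (V : normedModType R) n
    (f : V -> 'rV[R]_n) (h : V -> R) (x v : V) df dh :
  is_derive x v f df -> is_derive x v h dh ->
  is_derive x v (fun y => row_mx (f y) (h y)%:M : 'rV[R]_(n + 1))
    (row_mx df dh%:M).
Proof.
move=> [fx fxE] [hx hxE].
have entry i j : (fun y => (row_mx (f y) (h y)%:M : 'rV[R]_(n + 1)) i j) =
    match fintype.split j with inl k => fun y => f y i k | inr _ => h end.
  apply/funext => y; rewrite mxE; case: splitP => k _ //.
  by rewrite mxE !ord1.
have D : derivable (fun y => row_mx (f y) (h y)%:M : 'rV[R]_(n + 1)) x v.
  apply/derivable_mxP => i j; rewrite entry; case: splitP => k _ //.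
  by move/derivable_mxP : fx; apply.
apply: DeriveDef => //; rewrite derive_mx //; apply/matrixP => i j.
rewrite mxE entry mxE; case: splitP => k _; last by rewrite mxE !ord1 hxE.
by rewrite -fxE derive_mx // mxE.
Qed.

(** If [l > 0], then [g t / t] is positive for small [t], and [f] would increase strictly to the
    right of its maximum. Naming the derivative [g] lets the second derivative be taken at 0
    alone. *)
Lemma second_derivative_le0 (R : realType) (f g : R -> R) (l : R) :
  (\forall t \near (0 : R), is_derive (t : R) 1 f (g t)) ->
  is_derive (0 : R) 1 g l ->
  (\forall t \near (0 : R), f t <= f 0) -> g 0 = 0 /\ l <= 0.
Proof.
move=> fD gD fmax.
have : \forall t \near (0 : R), is_derive (t : R) 1 f (g t) /\ f t <= f 0.
  by near=> t; split; near: t.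
move=> /nbhs_ballP[e /= e0 eP].
have inE (t : R) : t \in `]-e, e[ -> is_derive t 1 f (g t) /\ f t <= f 0.
  move=> te; apply: eP; rewrite -ball_normE /= sub0r normrN ltr_norml.
  by rewrite in_itv in te.
have g0 : g 0 = 0.
  have z : 0 \in `]-e, e[ by rewrite in_itv /= oppr_lt0 e0.
  have d0 : is_derive (0 : R) 1 f 0.
    apply: (@derive1_at_max _ f (-e) e) => //.
    - lra.
    - by move=> t /inE[[]].
    - by move=> t /inE[].
  have [[_ <-] _] := inE _ z; by case: d0.
split=> //; rewrite leNgt; apply/negP => l0.
have : h^-1 * g h @[h --> 0^'] --> l.
  case: gD => gd <-; move: gd; rewrite /derivable /derive.
  have -> // : (fun h => h^-1 *: ((g \o shift 0) (h *: 1) - g 0)) =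
      (fun h => h^-1 * g h).
  by apply/funext => h; rewrite /= addr0 g0 subr0 [h *: 1]mulr1.
move=> /cvgr_gt/(_ _ l0) /= /nbhs_ballP[d /= d0 dP].
(* Halving keeps [[0, m]] inside both balls: the one where [f] is controlled and the one where
   [t^-1 * g t] is positive. *)
pose m := Num.min (e / 2) (d / 2).
have m0 : 0 < m by rewrite lt_min !divr_gt0.
have [me md] : m <= e / 2 /\ m <= d / 2 by rewrite !ge_min !lexx orbT.
have fin (t : R) : t \in `[0, m] -> is_derive t 1 f (g t) /\ f t <= f 0.
  by rewrite in_itv /= => /andP[? ?]; apply: inE; rewrite in_itv /=; lra.
have : f 0 < f m.
  apply: (@gtr0_derive1_lt_cc _ f 0 m) => //.
  - by move=> t /subset_itv_oo_cc /fin[[]].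
  - move=> t tm; have [[_ gt] _] := fin _ (subset_itv_oo_cc tm).
    rewrite derive1E gt; move: tm; rewrite in_itv /= => /andP[t0 tm].
    have : 0 < t^-1 * g t.
      apply: dP; last by rewrite gt_eqF.
      by rewrite -ball_normE /= sub0r normrN ger0_norm; lra.
    by rewrite pmulr_rgt0 ?invr_gt0.
  - by apply: derivable_within_continuous => t /fin[[]].
  - by rewrite in_itv /= lexx ltW.
  - by rewrite in_itv /= lexx ltW.
have : m \in `[0, m] by rewrite in_itv /= lexx ltW.
by move=> /fin[_]; rewrite leNgt => /negP.
Unshelve. all: by end_near. Qed.

(** * Restriction to lines *)

Section Line.
Context {R : realType} {V : normedModType R}.

Lemma is_derive_line (h : V -> R) (x v : V) (t dh : R) :
  is_derive (x + t *: v) v h dh ->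
  is_derive t 1 (fun s => h (x + s *: v)) dh.
Proof.
have E : (fun k => k^-1 *: (((fun s => h (x + s *: v)) \o shift t) (k *: 1) -
      h (x + t *: v))) =
    (fun k => k^-1 *: ((h \o shift (x + t *: v)) (k *: v) - h (x + t *: v))).
  apply/funext => k /=; congr (_ *: (h _ - _)).
  by rewrite [k *: 1]mulr1 scalerDl addrCA.
case=> Dh <-; apply: DeriveDef; first by rewrite /derivable E.
by rewrite /derive E.
Qed.

Lemma near_line (P : set V) (x v : V) :
  (\near x, P x) -> \forall t \near (0 : R), P (x + t *: v).
Proof.
move=> Px; have : (fun t : R => x + t *: v) @ 0 --> x.
  rewrite -[X in _ --> X]addr0 -(scale0r v).
  by apply: cvgD; [exact: cvg_cst|apply: cvgZr_tmp; exact: cvg_id].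
by apply.
Qed.

End Line.

Section GraphGeometry.
Context {R : realType} {n : nat}.
Variables (Omega : set 'rV[R]_n) (u : 'rV[R]_n -> R).
Hypotheses (Omega_open : open Omega) (u_C2 : class_C 2 Omega u).

Lemma near_open x : Omega x -> \forall y \near x, Omega y.
Proof. by move=> xO; apply: open_nbhs_nbhs; split. Qed.

Lemma C2_differentiable x : Omega x -> differentiable u x.
Proof. by case: u_C2 => + _; apply. Qed.

Lemma C2_derive_differentiable v x : Omega x -> differentiable ('D_v u) x.
Proof. by case: u_C2 => _ /(_ v)[+ _]; apply. Qed.

Lemma derive_partial (h : 'rV[R]_n -> R) x (v : 'rV_n) :
  differentiable h x -> 'D_v h x = \sum_i v 0 i * partial i h x.
Proof.
move=> hx; rewrite deriveE // {1}[v]row_sum_delta linear_sum.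
by apply: eq_bigr => i _; rewrite linearZ /partial deriveE.
Qed.

Definition hessian x : 'M[R]_n := \matrix_(i, j) partial i (partial j u) x.

Lemma derive2_hessian x (v : 'rV_n) : Omega x ->
  'D_v ('D_v u) x = (v *m hessian x *m v^T) 0 0.
Proof.
move=> xO.
(* The expansion of ['D_v u] in partial derivatives is available on [Omega]; openness makes it an
   identity near [x], which may be differentiated again. *)
have -> : 'D_v ('D_v u) x = 'D_v (\sum_j v 0 j \*: partial j u) x.
  apply: near_eq_derive; near=> y; rewrite derive_partial ?fct_sumE //.
  by apply: C2_differentiable; near: y; exact: near_open.
rewrite derive_sum; last first.
  by move=> j; apply/derivableZ/diff_derivable/C2_derive_differentiable.
rewrite mxE; apply: eq_bigr => j _; rewrite deriveZ; last first.
  exact/diff_derivable/C2_derive_differentiable.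
rewrite derive_partial; last exact: C2_derive_differentiable.
rewrite mxE mxE [LHS]mulrC; congr (_ * _).
by apply: eq_bigr => i _; rewrite mxE.
Unshelve. all: by end_near. Qed.

Lemma partial_graph x i : Omega x ->
  partial i (graph_imm u) x = row_mx (delta_mx 0 i) (partial i u x)%:M.
Proof.
move=> xO; have ux : is_derive x (delta_mx 0 i) u (partial i u x).
  by apply/derivableP/diff_derivable/C2_differentiable.
by have [_] := is_derive_row_mx (is_derive_id x (delta_mx 0 i)) ux.
Qed.

Lemma partial2_graph x i j : Omega x ->
  partial i (partial j (graph_imm u)) x = row_mx 0 (hessian x i j)%:M.
Proof.
move=> xO; have ux : is_derive x (delta_mx 0 i) (partial j u) (hessian x i j).
  by rewrite mxE; apply/derivableP/diff_derivable/C2_derive_differentiable.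
have [_ <-] := is_derive_row_mx (is_derive_cst (delta_mx 0 j) x _) ux.
apply: near_eq_derive; near=> y; rewrite partial_graph //.
by near: y; exact: near_open.
Unshelve. all: by end_near. Qed.

(** The rows are the coordinate tangent vectors of the graph, which makes [J *m J^T] the metric. *)
Definition graph_jacobian x : 'M[R]_(n, n + 1) :=
  row_mx 1%:M (gradient u x)^T.

Definition area_element x : R := Num.sqrt (1 + enorm (gradient u x) ^+ 2).

Local Notation J := (graph_jacobian).
Local Notation N := (upper_normal u).

Lemma row_graph_jacobian x i : Omega x ->
  partial i (graph_imm u) x = row i (J x).
Proof.
move=> xO; rewrite partial_graph // row_row_mx row1; congr row_mx.
by rewrite [RHS]mx11_scalar !mxE.
Qed.

Lemma area_element_sqr x :
  area_element x ^+ 2 = 1 + (gradient u x *m (gradient u x)^T) 0 0.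
Proof.
by rewrite sqr_sqrtr enorm_sqr dotvE // addr_ge0 // mulmx_tr_ge0.
Qed.

Lemma area_element_gt0 x : 0 < area_element x.
Proof. by rewrite sqrtr_gt0 ltr_pwDl // enorm_sqr dotvE mulmx_tr_ge0. Qed.

Lemma graph_metric x :
  J x *m (J x)^T = 1%:M + (gradient u x)^T *m gradient u x.
Proof. by rewrite tr_row_mx mul_row_col trmx1 mulmx1 trmxK. Qed.

(** The metric in the form [|v|^2 + (D_v u)^2] that the second-order condition at a contact point
    produces. *)
Lemma graph_metric_quad x (v : 'rV_n) :
  (v *m (J x *m (J x)^T) *m v^T) 0 0 =
  (v *m v^T) 0 0 + ((v *m (gradient u x)^T) 0 0) ^+ 2.
Proof.
rewrite graph_metric mulmxDr mulmx1 mulmxDl mxE; congr (_ + _).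
have -> : v *m ((gradient u x)^T *m gradient u x) *m v^T =
    v *m (gradient u x)^T *m (v *m (gradient u x)^T)^T.
  by rewrite trmx_mul trmxK !mulmxA.
rewrite [v *m _]mx11_scalar tr_scalar_mx -scalar_mxM expr2.
by rewrite !mxE !eqxx !mulr1n.
Qed.

Lemma graph_metric_posdef x : posdef (J x *m (J x)^T).
Proof.
by move=> v v0; rewrite graph_metric_quad ltr_pwDl ?sqr_ge0 ?mulmx_tr_gt0.
Qed.

Lemma normal_unit x : N x *m (N x)^T = 1%:M.
Proof.
rewrite /upper_normal -/(area_element x) linearZ /= -scalemxAl -scalemxAr.
rewrite scalerA tr_row_mx mul_row_col linearN /= mulNmx mulmxN opprK trmx1.
rewrite mulmx1.
rewrite [_ *m _^T]mx11_scalar -raddfD /= addrC -area_element_sqr.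
rewrite scale_scalar_mx -expr2 -exprMn mulVf ?expr1n //.
by rewrite gt_eqF // area_element_gt0.
Qed.

Lemma normal_tangent x : J x *m (N x)^T = 0.
Proof.
rewrite /upper_normal linearZ /= -scalemxAr tr_row_mx mul_row_col.
by rewrite linearN /= trmx1 mul1mx mulmx1 addNr scaler0.
Qed.

(** Second derivatives of the graph map are vertical, and the vertical component of [N] is the
    inverse area element; hence the second form is the Hessian divided by [area_element]. *)
Lemma wmc_graph (G : 'rV[R]_(n + 1) -> 'M[R]_(n + 1)) x : Omega x ->
  (G (N x))^T = G (N x) ->
  weighted_mean_curvature (graph_imm u) N G x =
  \tr (invmx (J x *m (J x)^T) *m (J x *m G (N x) *m (J x)^T) *m
    (invmx (J x *m (J x)^T) *m ((area_element x)^-1 *: hessian x))).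
Proof.
move=> xO Gsym.
have entry m (A B : 'M[R]_(n, m)) i j :
    (row i A *m (row j B)^T) 0 0 = (A *m B^T) i j.
  by rewrite tr_row !mxE; apply: eq_bigr => k _; rewrite !mxE.
have gE : first_form (graph_imm u) x = J x *m (J x)^T.
  by apply/matrixP => i j; rewrite mxE dotvE !row_graph_jacobian ?entry.
rewrite /weighted_mean_curvature /shape_operator gE; congr (\tr (_ *m _ *m _)).
  apply/matrixP => i j; rewrite mxE dotvE !row_graph_jacobian // /mxapp Gsym.
  by rewrite -row_mul entry.
congr (_ *m _); apply/matrixP => i j; rewrite !mxE dotvE partial2_graph //.
rewrite /upper_normal -/(area_element x) linearZ /= -scalemxAr tr_row_mx.
by rewrite mul_row_col mul0mx add0r trmx1 mulmx1 !mxE eqxx mulr1n.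
Qed.

End GraphGeometry.

(** * Contact with spheres *)

(** Along a line [x + t v] the quadratic in [t] is the squared length and [h] the height over the
    centre of the sphere. The conclusions are the first- and second-order conditions, the latter
    halved. *)
Lemma quadratic_add_sqr_max (R : realType) (h dh : R -> R) (a b c ddh : R) :
  (\forall t \near (0 : R), is_derive (t : R) 1 h (dh t)) ->
  is_derive (0 : R) 1 dh ddh ->
  (\forall t \near (0 : R),
     a + t * b + t ^+ 2 * c + h t ^+ 2 <= a + h 0 ^+ 2) ->
  b + 2 * (h 0 * dh 0) = 0 /\ c + dh 0 ^+ 2 + h 0 * ddh <= 0.
Proof.
move=> hD dhD hmax.
pose f t := a + t * b + t ^+ 2 * c + h t ^+ 2.
pose g t := b + 2 * t * c + 2 * (h t * dh t).
pose l := 2 * c + 2 * (dh 0 * dh 0 + h 0 * ddh).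
have h0 : is_derive (0 : R) 1 h (dh 0) := nbhs_singleton hD.
have fD : \forall t \near (0 : R), is_derive (t : R) 1 f (g t).
  apply: filterS hD => t hD.
  have tD := is_derive_id t 1.
  have -> : f = cst a + b \*: id + c \*: (id * id) + h * h.
    by apply/funext => y; rewrite /f !fctE /= /GRing.scale /=; ring.
  by apply: is_derive_eq; rewrite /g /GRing.scale /=; ring.
have gD : is_derive (0 : R) 1 g l.
  have tD := is_derive_id (0 : R) 1.
  have -> : g = cst b + (2 * c) \*: id + 2 \*: (h * dh).
    by apply/funext => y; rewrite /g !fctE /= /GRing.scale /=; ring.
  by apply: is_derive_eq; rewrite /l /GRing.scale /=; ring.
have f0 : f 0 = a + h 0 ^+ 2 by rewrite /f; ring.
have [|] := second_derivative_le0 fD gD.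
  by rewrite f0.
by rewrite /g /l; split; lra.
Qed.

Section Contact.
Context {R : realType} {n : nat}.
Variables (Omega : set 'rV[R]_n) (u : 'rV[R]_n -> R).
Hypotheses (Omega_open : open Omega) (u_C2 : class_C 2 Omega u).

(** The second-order condition in direction [v] is [g(v,v) + d s D_v D_v u <= 0]. The first-order
    conditions give [rho = d W] with [W] the area element, and dividing by [rho] yields the
    claim. *)
Lemma sphere_contact x (s c rho : R) : Omega x -> s ^+ 2 = 1 ->
  0 < rho -> c < s * u x -> dotv x x + (s * u x - c) ^+ 2 = rho ^+ 2 ->
  (\forall y \near x, dotv y y + (s * u y - c) ^+ 2 <= rho ^+ 2) ->
  forall v : 'rV_n,
  s * (v *m ((area_element u x)^-1 *: hessian u x) *m v^T) 0 0 <=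
  - (rho^-1 * (v *m (graph_jacobian u x *m (graph_jacobian u x)^T) *m v^T) 0 0).
Proof.
move=> xO s1 rho0; rewrite -subr_gt0; set d := s * u x - c => d0 sphere ball.
have line v : dotv x v + d * (s * 'D_v u x) = 0 /\
    dotv v v + 'D_v u x ^+ 2 + d * (s * 'D_v ('D_v u) x) <= 0.
  pose h t := s * u (x + t *: v) - c.
  pose dh t := s * 'D_v u (x + t *: v).
  have hD : \forall t \near (0 : R), is_derive (t : R) 1 h (dh t).
    apply: filterS (near_line v (near_open Omega_open xO)) => t tO.
    have lD := is_derive_line
      (derivableP (diff_derivable (v := v) (C2_differentiable u_C2 tO))).
    have -> : h = s \*: (fun t => u (x + t *: v)) - cst c by [].
    by apply: is_derive_eq; rewrite subr0.
  have x0O : Omega (x + 0 *: v) by rewrite scale0r addr0.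
  have dhD : is_derive (0 : R) 1 dh (s * 'D_v ('D_v u) x).
    have lD := is_derive_line (derivableP
      (diff_derivable (v := v) (C2_derive_differentiable u_C2 v x0O))).
    have -> : dh = s \*: (fun t => 'D_v u (x + t *: v)) by [].
    by apply: is_derive_eq; rewrite scale0r addr0.
  have [|] := @quadratic_add_sqr_max _ h dh (dotv x x) (2 * dotv x v)
    (dotv v v) _ hD dhD.
    apply: filterS (near_line v ball) => t; rewrite /h scale0r addr0 -/d sphere.
    apply: le_trans; rewrite lerD2r !dotvE.
    rewrite [(x + _)^T]linearD /= linearZ /= !mulmxDl !mulmxDr -!scalemxAl.
    rewrite -!scalemxAr !mxE.
    have -> : \sum_j v 0 j * x^T j 0 = \sum_j x 0 j * v^T j 0.
      by apply: eq_bigr => j _; rewrite !mxE mulrC.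
    rewrite le_eqVlt; apply/orP; left; apply/eqP. ring.
  rewrite /h /dh scale0r addr0 -/d exprMn s1 mul1r => e1 e2; split => //; lra.
have dotD v : 'D_v u x = dotv v (gradient u x).
  rewrite derive_partial; last exact: C2_differentiable xO.
  by apply: eq_bigr => i _; rewrite mxE.
(* The first-order conditions say x = - d s grad u. *)
have radius : rho = d * area_element u x.
  have W0 := area_element_gt0 u x.
  apply/eqP; rewrite -(@eqrXn2 _ 2) ?ltW ?mulr_gt0 //; apply/eqP.
  rewrite exprMn area_element_sqr -sphere -dotvE.
  have [e1 _] := line x; have [e2 _] := line (gradient u x).
  rewrite !dotD in e1 e2.
  have -> : dotv x x = d ^+ 2 * s ^+ 2 * dotv (gradient u x) (gradient u x).
    have -> : dotv x x = - (d * (s * dotv x (gradient u x))) by lra.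
    have -> : dotv x (gradient u x) =
      - (d * (s * dotv (gradient u x) (gradient u x))) by lra.
    by ring.
  rewrite s1; ring.
move=> v; have [_] := line v.
rewrite (derive2_hessian Omega_open u_C2) // graph_metric_quad dotvE dotD.
rewrite !dotvE -scalemxAr -scalemxAl [X in s * X <= _]mxE radius.
set W := area_element u x; have W0 : 0 < W := area_element_gt0 u x.
set q := (v *m v^T) 0 0; set p := (v *m _^T) 0 0; set b := (_ *m v^T) 0 0.
move=> le0; rewrite -subr_le0.
have -> : s * (W^-1 * b) - - ((d * W)^-1 * (q + p ^+ 2)) =
    (d * W)^-1 * (q + p ^+ 2 + d * (s * b)).
  by field; rewrite !gt_eqF.
by rewrite pmulr_rle0 // invr_gt0 mulr_gt0.
Qed.

End Contact.

(** * Compactness and the first contact point *)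

Lemma dotv_continuous (R : realType) m :
  continuous (fun x : 'rV[R]_m => dotv x x).
Proof.
move=> x; apply/differentiable_continuous.
have -> : (fun x : 'rV[R]_m => dotv x x) =
    \sum_(i < m) ((fun x : 'rV[R]_m => x 0 i) * (fun x => x 0 i)).
  by apply/funext => y; rewrite fct_sumE.
by apply: differentiable_sum => i; apply: differentiableM;
  exact: differentiable_coord.
Qed.

Lemma compact_closure (R : realType) m (A : set 'rV[R]_m) :
  bounded_set A -> compact (closure A).
Proof.
move=> [M [_ /(_ (M + 1))]]; rewrite ltrDl => /(_ ltr01) AM.
have sub : closure A `<=` [set x | `|x| <= M + 1].
  rewrite [X in _ `<=` X](closure_id _).1; first exact: closure_subset.
  have /continuous_closedP := @norm_continuous _ 'rV[R]_m.
  by move=> /(_ _ (@closed_le R (M + 1))).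
apply: bounded_closed_compact; last exact: closed_closure.
exists (M + 1); split; first exact: num_real.
by move=> K MK x /sub /= /le_trans; apply; exact: ltW.
Qed.

Lemma within_continuous_min (T : topologicalType) (R : realType) (A : set T)
    (f g : T -> R) :
  {within A, continuous f} -> {within A, continuous g} ->
  {within A, continuous (fun x => Num.min (f x) (g x))}.
Proof.
move=> cf cg x; apply: continuous2_cvg (cf x) (cg x).
exact: (@min_continuous _ R (f x, g x)).
Qed.

Section OneSidedBound.
Context {R : realType} {n : nat}.
Variables (Omega : set 'rV[R]_n) (u : 'rV[R]_n -> R).
Hypotheses (Omega_open : open Omega) (Omega_bounded : bounded_set Omega).
Hypothesis u_C0 : {within closure Omega, continuous u}.
Hypothesis u_cont : forall x, Omega x -> {for x, continuous u}.

Lemma open_closure_boundary x : closure Omega x -> Omega x \/ boundary Omega x.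
Proof.
move=> clx; have [|nx] := pselect (Omega x); [by left|right].
by split => // /interior_subset.
Qed.

(** Lowering a half-sphere [w] to first contact means maximising [s * u - w] over the compact
    closure; the maximal value is the height [c] of the centre. *)
Lemma exists_contact (s r M : R) (x0 : 'rV_n) :
  0 < r -> Omega `<=` eball r -> Omega x0 ->
  (forall x, boundary Omega x -> s * u x <= M) -> M + r < s * u x0 ->
  exists x c rho, [/\ Omega x, 0 < rho < r, c < s * u x,
    dotv x x + (s * u x - c) ^+ 2 = rho ^+ 2 &
    \forall y \near x, dotv y y + (s * u y - c) ^+ 2 <= rho ^+ 2].
Proof.
move=> r0 Or x0O uM ux0.
pose K := closure Omega.
have Kc : compact K := compact_closure Omega_bounded.
have Kne : K !=set0 by exists x0; exact: subset_closure.
have scont : {within K, continuous (fun x => s * u x)}.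
  move=> x; apply: cvgM; [exact: cvg_cst|exact: u_C0].
have econt : continuous (fun x : 'rV[R]_n => enorm x).
  move=> x; apply: (continuous_comp (@dotv_continuous _ _ x)).
  exact: sqrt_continuous.
(* A level that the contact point must exceed: the half-sphere has heights between 0 and [rho < r],
   so comparison with [x0] gives [M' < s * u x]. *)
pose M' := s * u x0 - r; have MM' : M < M' by rewrite ltrBrDr.
(* The minimum below is negative on the whole of K, hence bounded away from 0:
   this is what leaves room for a radius smaller than r. *)
have [z zK zmax] : exists2 z, z \in K & forall x, x \in K ->
    Num.min (s * u x - M') (enorm x - r) <=
    Num.min (s * u z - M') (enorm z - r).
  apply: compact_EVT_max => //; apply: within_continuous_min.
    by move=> x; apply: cvgB; [exact: scont|exact: cvg_cst].
  apply: continuous_subspaceT => x.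
  exact: (cvgB (econt x) (cvg_cst r)).
set e := Num.min _ _ in zmax.
have e0 : e < 0.
  rewrite gt_min; move: zK; rewrite inE => /open_closure_boundary[/Or|/uM] zz.
    by apply/orP; right; rewrite subr_lt0.
  by apply/orP; left; rewrite subr_lt0 (le_lt_trans zz).
(* Here the first argument of the minimum is nonnegative, hence above [e], so the second one is at
   most [e]. *)
have low x : K x -> M' <= s * u x -> enorm x <= r + e.
  move=> xK ux; have := zmax x; rewrite inE => /(_ xK).
  rewrite ge_min => /orP[|]; lra.
have re : 0 <= r + e.
  rewrite (le_trans _ (low x0 _ _)) ?sqrtr_ge0 //; first exact: subset_closure.
  by rewrite /M'; lra.
(* Halfway between [r], which it must stay below, and [r + e], the bound of [low]. *)
pose rho := r + e / 2.
have [rho0 rhor erho] : [/\ 0 < rho, rho < r & r + e < rho].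
  by rewrite /rho; split; lra.
(* Since [Num.sqrt] is 0 on negative numbers, [w] is continuous and nonnegative also outside the
   ball of radius [rho]. *)
pose w (x : 'rV[R]_n) := Num.sqrt (rho ^+ 2 - dotv x x).
have wcont : continuous w.
  move=> x; apply: (@continuous_comp _ _ _
    (fun x => rho ^+ 2 - dotv x x) Num.sqrt); last exact: sqrt_continuous.
  exact: (cvgB (cvg_cst _) (@dotv_continuous _ _ x)).
have [x xK xmax] : exists2 x, x \in K &
    forall y, y \in K -> s * u y - w y <= s * u x - w x.
  apply: compact_EVT_max => // x; apply: cvgB; first exact: scont.
  exact: continuous_subspaceT.
have {}xK : K x by rewrite inE in xK.
have {}xmax y : K y -> s * u y - w y <= s * u x - w x.
  by move=> yK; apply: xmax; rewrite inE.
have wx0 : w x0 <= rho.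
  rewrite /w -[leRHS](ger0_norm (ltW rho0)) -sqrtr_sqr ler_wsqrtr //.
  by rewrite lerBlDr lerDl dotvE mulmx_tr_ge0.
have w_ge0 y : 0 <= w y by exact: sqrtr_ge0.
have ux : M' < s * u x.
  have := xmax x0 (subset_closure x0O); have := w_ge0 x.
  by rewrite /M'; lra.
have xO : Omega x.
  by case: (open_closure_boundary xK) => // /uM; rewrite leNgt (lt_trans MM' ux).
have xrho : enorm x < rho by rewrite (le_lt_trans _ erho) // low // ltW.
have wsqr y : enorm y < rho -> 0 < w y /\ dotv y y + w y ^+ 2 = rho ^+ 2.
  move=> yrho; have d0 : 0 < rho ^+ 2 - dotv y y.
    by rewrite subr_gt0 -enorm_sqr ltrXn2r // ?nnegrE ?sqrtr_ge0 // ltW.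
  by rewrite sqrtr_gt0 sqr_sqrtr ?ltW //; split=> //; ring.
have [wx xE] := wsqr x xrho.
exists x, (s * u x - w x), rho; split => //; first by rewrite rho0.
- by rewrite ltrBlDr ltrDl.
- by rewrite subKr.
near=> y.
have yO : Omega y by near: y; exact: open_nbhs_nbhs.
have yrho : enorm y < rho.
  by near: y; have /cvgr_lt := econt x; apply.
have yc : s * u x - w x < s * u y.
  near: y; have /cvgr_gt : s * u y @[y --> x] --> s * u x.
    exact: (cvgM (cvg_cst s) (u_cont xO)).
  by apply; rewrite ltrBlDr ltrDl.
have [wy <-] := wsqr y yrho.
have := xmax y (subset_closure yO) => uy.
rewrite lerD2l ler_pXn2r // ?nnegrE; lra.
Unshelve. all: by end_near. Qed.

End OneSidedBound.

(** * The height estimate *)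

Lemma wmc_no_contact (R : realType) (n : nat)
    (G : 'rV[R]_(n + 1) -> 'M[R]_(n + 1)) (Omega : set 'rV[R]_n)
    (u : 'rV[R]_n -> R) (s c rho r : R) (x : 'rV_n) :
  (0 < n)%N -> weight_matrix G -> open Omega -> class_C 2 Omega u ->
  Omega x -> s ^+ 2 = 1 -> 0 < rho < r -> c < s * u x ->
  dotv x x + (s * u x - c) ^+ 2 = rho ^+ 2 ->
  (\forall y \near x, dotv y y + (s * u y - c) ^+ 2 <= rho ^+ 2) ->
  r^-1 * \tr (G (upper_normal u x)) <
  - (s * weighted_mean_curvature (graph_imm u) (upper_normal u) G x).
Proof.
move=> n_gt0 Gw Oo uC2 xO s1 /andP[rho0 rhor] cu sphere ball.
set N := upper_normal u x; have N1 : N *m N^T = 1%:M := normal_unit u x.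
have N0 : N != 0.
  by apply: contra_eq_neq N1 => ->; rewrite mul0mx eq_sym oner_neq0.
have Gsym := weight_sym Gw N0.
have Gker : N *m G N = 0 by have := weight_ker Gw N0; rewrite /mxapp Gsym.
have Gpos (y : 'rV_(n + 1)) :
    y *m N^T = 0 -> y != 0 -> 0 < (y *m G N *m y^T) 0 0.
  move=> yN y0; have := weight_pos Gw N0 _ y0.
  by rewrite !dotvE yN mxE /mxapp Gsym; apply.
have contact := sphere_contact Oo uC2 xO s1 rho0 cu sphere ball.
set J := graph_jacobian u x in contact.
set b := _ *: hessian u x in contact.
(* By [contact] this form is at least [(rho^-1 - r^-1) g], which is positive definite because
   [rho < r]. *)
have bpos : posdef (- s *: b + (- r^-1) *: (J *m J^T)).
  have quadD a k (B C : 'M[R]_n) (v : 'rV_n) :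
      (v *m (a *: B + k *: C) *m v^T) 0 0 =
      a * (v *m B *m v^T) 0 0 + k * (v *m C *m v^T) 0 0.
    by rewrite mulmxDr -!scalemxAr mulmxDl -!scalemxAl !mxE.
  move=> v v0; rewrite quadD.
  have := contact v; have := @graph_metric_posdef _ _ u x v v0; rewrite -/J.
  set q := (v *m (J *m J^T) *m v^T) 0 0; set p := (v *m b *m v^T) 0 0 => q0 le0.
  have : 0 < (rho^-1 - r^-1) * q.
    by rewrite mulr_gt0 // subr_gt0 ltf_pV2 // posrE (lt_trans rho0).
  lra.
have := weighted_trace_gt N1 (normal_tangent u x) (@graph_metric_posdef _ _ u x)
  Gsym Gker Gpos n_gt0 bpos.
rewrite (wmc_graph Oo uC2) // -/N -/J -/b -scalemxAr -scalemxAr mxtraceZ.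
by rewrite !mulNr opprK.
Qed.

(** The strict inequality at a contact point contradicts [HG] taken at [z = u x] and [p] the unit
    normal. The sign [s] treats upper and lower bounds at once. *)
Lemma one_sided_bound (R : realType) (n : nat)
    (G : 'rV[R]_(n + 1) -> 'M[R]_(n + 1)) (r : R) (Omega : set 'rV[R]_n)
    (u : 'rV[R]_n -> R) (H : 'rV[R]_n -> R -> R) (s M : R) :
  (0 < n)%N -> weight_matrix G -> 0 < r -> open Omega -> bounded_set Omega ->
  Omega `<=` eball r -> class_C 2 Omega u ->
  {within closure Omega, continuous u} -> prescribed_wmc u G Omega H ->
  (forall (x : 'rV[R]_n) (z : R) (p : 'rV[R]_(n + 1)),
    Omega x -> enorm p = 1 -> `|H x z| <= r^-1 * \tr (G p)) ->
  s ^+ 2 = 1 -> (forall x, boundary Omega x -> s * u x <= M) ->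
  forall x, Omega x -> s * u x <= M + r.
Proof.
move=> n_gt0 Gw r0 Oo Ob Or uC2 uC0 uH HG s1 uM x0 x0O.
rewrite leNgt; apply/negP => ux0.
have ucont x : Omega x -> {for x, continuous u}.
  by move=> /(C2_differentiable uC2) /differentiable_continuous.
have [x [c [rho [xO rho_r cu sphere ball]]]] :=
  exists_contact Oo Ob uC0 ucont r0 Or x0O uM ux0.
have := wmc_no_contact n_gt0 Gw Oo uC2 xO s1 rho_r cu sphere ball.
apply/negP; rewrite -leNgt uH //.
have N1 : enorm (upper_normal u x) = 1.
  by rewrite /enorm dotvE normal_unit mxE eqxx sqrtr1.
apply: le_trans (HG _ (u x) _ xO N1).
have s_norm : `|s| = 1.
  by apply/eqP; rewrite -(@eqrXn2 _ 2) // ?expr1n // real_normK ?num_real ?s1.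
by apply: le_trans (ler_norm _) _; rewrite normrN normrM s_norm mul1r.
Qed.

Theorem theorem2 (R : realType) (n : nat) (n_gt0 : (0 < n)%N)
    (G : 'rV[R]_(n + 1) -> 'M[R]_(n + 1))
    (G_weight : weight_matrix G)
    (G_C1 : class_C 1 [set p | p != 0] G)
    (r : R) (r_gt0 : 0 < r)
    (Omega : set 'rV[R]_n)
    (Omega_domain : is_domain Omega)
    (Omega_bounded : bounded_set Omega)
    (Omega_ball : Omega `<=` eball r)
    (u : 'rV[R]_n -> R)
    (u_C2 : class_C 2 Omega u)
    (u_C0 : {within closure Omega, continuous u})
    (H : 'rV[R]_n -> R -> R)
    (u_graph : prescribed_wmc u G Omega H)
    (H_bound : forall (x : 'rV[R]_n) (z : R) (p : 'rV[R]_(n + 1)),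
      Omega x -> enorm p = 1 -> `|H x z| <= r^-1 * \tr (G p)) :
  (ereal_sup [set `|u x|%:E | x in Omega] <=
   ereal_sup [set `|u x|%:E | x in boundary Omega] + r%:E)%E.
Proof.
case: Omega_domain => [[x0 x0O] Omega_open _].
have bound M : (forall x, boundary Omega x -> `|u x| <= M) ->
    forall x, Omega x -> `|u x| <= M + r.
  move=> uM x xO; have side s (s1 : s ^+ 2 = 1) :
      (forall y, boundary Omega y -> s * u y <= M) -> s * u x <= M + r.
    by move=> sM; exact: (one_sided_bound n_gt0 G_weight r_gt0 Omega_open
      Omega_bounded Omega_ball u_C2 u_C0 u_graph H_bound s1 sM).
  rewrite ler_norml lerNl -mulN1r -[u x in X in _ && X]mul1r.
  apply/andP; split; apply: side => [|y /uM]; rewrite ?sqrrN ?expr1n //.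
    by rewrite ler_norml lerNl mulN1r => /andP[].
  by rewrite ler_norml mul1r => /andP[].
have sup_ub x : boundary Omega x ->
    (`|u x|%:E <= ereal_sup [set `|u x|%:E | x in boundary Omega])%E.
  by move=> xB; apply: ereal_sup_ubound; exists x.
apply: ge_ereal_sup => _ [x xO <-].
case: (ereal_sup _) sup_ub => [M||] sup_ub.
- by rewrite -EFinD lee_fin; apply: bound => // y /sup_ub.
- by rewrite addye ?leey.
(* A supremum [-oo] leaves no boundary point, so any [M] bounds [u] there; this choice gives the
   absurd [|u x| <= |u x| - 1]. *)
- have : `|u x| <= `|u x| - r - 1 + r.
    by apply: bound => // y /sup_ub; rewrite leeNy_eq.
  by rewrite addrAC subrK lerBrDr gerDl ler10.
Qed.
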